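(* Let $(X,\mathcal{A})$ be a measurable space. Then the following statements are equivalent. (1) $(X,\mathcal{A})$ is a $T$-measurable space. (2) If $x$ and $y$ are distinct points in $X$, then $M_x\neq M_y$. (3) For every maximal ideal $M$ in $M(X)$, $\left|\bigcap_{f\in M}Z(f)\right|\le 1$.
   Context: A measurable space $(X,\mathcal{A})$ is a nonempty set $X$ with a $\sigma$-algebra $\mathcal{A}$ of subsets of $X$. $M(X)$ is the commutative ring (pointwise operations) of all functions $f:X\to\mathbb{R}$ with $f^{-1}(V)\in\mathcal{A}$ for every open $V\subseteq\mathbb{R}$. For $f\in M(X)$, $Z(f)=\{x\in X: f(x)=0\}$. For $p\in X$, $M_p=\{f\in M(X): f(p)=0\}$. A measurable space is $T$-measurable if whenever $x,y$ are distinct points of it, there is a measurable set containing one of them and not the other. *)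

(* Defs.v *)
From HB Require Import structures.
From mathcomp Require Import all_boot all_order all_algebra ring_quotient.
From mathcomp Require Import all_classical all_reals all_analysis measurable_realfun.

Set Implicit Arguments.
Unset Strict Implicit.
Unset Printing Implicit Defensive.

Import Order.TTheory GRing.Theory Num.Theory.
Import numFieldNormedType.Exports.

Local Open Scope classical_set_scope.
Local Open Scope ring_scope.

(* [idealr_closed] includes [1 \notin I], so only proper ideals are compared. *)
Definition maximal_ideal (A : comNzRingType) (M : set A) : Prop :=
  idealr_closed [in M] /\
  forall I : set A, idealr_closed [in I] -> M `<=` I -> I = M.

(* The ring M(X) is [{mfun X >-> R}] with its pointwise ring structure.
   Its measurability condition is stated with the Borel sets of [R];
   it amounts to measurability of the preimages of open sets. *)
Lemma measurable_fun_openP d (X : measurableType d) (R : realType)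
    (f : X -> R) :
  measurable_fun setT f <->
  forall V : set R, open V -> measurable (f @^-1` V).
Proof.
split=> [mf V oV|mf].
  by rewrite -[_ @^-1` _]setTI; apply: mf => //; exact: open_measurable.
apply: (measurability _ (RGenOpens.measurableE R)).
move=> _ [_ [a [b ->]] <-]; rewrite setTI; apply: mf.
exact: interval_open.
Qed.

Definition zero_set d (X : measurableType d) (R : realType)
    (f : {mfun X >-> R}) : set X :=
  [set x | f x = 0].

Definition point_ideal d (X : measurableType d) (R : realType) (p : X) :
    set {mfun X >-> R} :=
  [set f : {mfun X >-> R} | f p = 0].
Arguments point_ideal {d X} R p.

(* A [measurableType] is pointed, hence nonempty. *)
Definition T_measurable d (X : measurableType d) : Prop :=
  forall x y : X, x <> y ->
    exists A : set X,
      measurable A /\ ((A x /\ ~ A y) \/ (A y /\ ~ A x)).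

(* Main.v *)
Require Import Defs.
From mathcomp Require Import all_boot all_order all_algebra ring_quotient.
From mathcomp Require Import all_classical all_reals all_analysis measurable_realfun.

(** Every point ideal [M_x] is maximal, being the kernel of the evaluation at
    [x], a map onto the field [R] ([point_ideal_maximal]).  Moreover, a maximal
    ideal [M] all of whose members vanish at [x] is contained in [M_x], hence
    equal to it ([maximal_ideal_common_zero]).  So the common zeros of [M] are
    exactly the points [x] with [M_x = M], and each maximal ideal has at most
    one common zero as soon as points are determined by their ideals.

    The link with measurable sets goes through indicators and zero sets.  The
    indicator of a measurable set distinguishes the ideals of two points that
    the set separates.  Conversely, if [M_x] has [x] as its only common zero
    and [y] is another point, some [f] in [M_x] does not vanish at [y], and the
    measurable set [Z(f)] contains [x] but not [y]. *)

Import GRing.Theory.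

Local Open Scope classical_set_scope.
Local Open Scope ring_scope.
Local Open Scope card_scope.

Lemma card_le_I1P (T : Type) (A : set T) : A #<= `I_1 <-> is_subset1 A.
Proof.
split=> [/card_leP[f] x y Ax Ay|A1].
  have f0 (u : A) : val (f u) = 0%N.
    by have /set_mem/= := valP (f u); rewrite ltnS leqn0 => /eqP.
  have /(inj (mem_setT _) (mem_setT _)) : f (SigSub (mem_set Ax)) =
      f (SigSub (mem_set Ay)) by apply: val_inj; rewrite !f0.
  by move=> /(congr1 val).
have [->|/set0P[x Ax]] := eqVneq A set0; first exact: card_ge0.
rewrite -(card_le_eqr (card_set1 (x := x))).
by apply: subset_card_le => y Ay; exact: A1.
Qed.

Section point_ideals.
Context {R : realType} {d : measure_display} {X : measurableType d}.
Implicit Types (x y : X) (M : set {mfun X >-> R}).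

Lemma measurable_zero_set (f : {mfun X >-> R}) : measurable (zero_set f).
Proof.
rewrite -[zero_set f]setTI.
exact: (measurable_funPT f measurableT [set 0] (measurable_set1 0)).
Qed.

Lemma point_ideal_closed x : idealr_closed [in point_ideal R x].
Proof.
split.
- by rewrite inE.
- by rewrite notin_setE; exact/eqP/oner_neq0.
- move=> a f g; rewrite !inE /point_ideal/= => f0 g0.
  by change (a x * f x + g x = 0); rewrite f0 g0 mulr0 addr0.
Qed.

(** If an ideal above [M_x] contains some [f] with [f x != 0], then it contains
    [1], since [1 - (f x)^-1 * f] belongs to [M_x]. *)
Lemma point_ideal_maximal x : maximal_ideal (point_ideal R x).
Proof.
split=> [|I [_ I1 Iadd] MI]; first exact: point_ideal_closed.
apply/seteqP; split=> // f If; apply: contrapT => /eqP fx0.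
pose c : {mfun X >-> R} := cst (f x)^-1.
have Ig : I (1 - c * f).
  by apply: MI; change (1 - (f x)^-1 * f x = 0); rewrite mulVf// subrr.
move/negP: I1; apply.
by rewrite -(subrKC (c * f) 1) Iadd// inE.
Qed.

Lemma maximal_ideal_common_zero M x :
  maximal_ideal M -> (\bigcap_(f in M) zero_set f) x -> point_ideal R x = M.
Proof. by move=> [_ Mmax] Mx; apply: Mmax => //; exact: point_ideal_closed. Qed.

Lemma point_ideal_separated (A : set X) x y :
  measurable A -> A x -> ~ A y -> point_ideal R x <> point_ideal R y.
Proof.
move=> mA Ax Ay /seteqP[_ /(_ (indic_mfun A mA))].
rewrite /point_ideal/= !mindicE (mem_set Ax) (memNset Ay).
by move=> /(_ erefl)/eqP; rewrite oner_eq0.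
Qed.

End point_ideals.

Theorem proposition18 (R : realType) (d : measure_display)
    (X : measurableType d) :
  [<-> T_measurable X;
       forall x y : X, x <> y -> point_ideal R x <> point_ideal R y;
       forall M : set {mfun X >-> R}, maximal_ideal M ->
         (\bigcap_(f in M) zero_set f) #<= `I_1].
Proof.
tfae.
- move=> TX x y /TX[A [mA [[Ax Ay]|[Ay Ax]]]].
    exact: point_ideal_separated mA Ax Ay.
  by apply/nesym; exact: point_ideal_separated mA Ay Ax.
- move=> Minj M Mmax; apply/card_le_I1P => x y Mx My.
  apply: contrapT => /Minj; apply.
  by rewrite !(maximal_ideal_common_zero M).
- move=> Mle1 x y xy.
  have /card_le_I1P Mx1 := Mle1 _ (point_ideal_maximal x).
  have [f fx fy] : exists2 f : {mfun X >-> R}, f x = 0 & f y <> 0.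
    apply: contrapT => nf; apply: xy; apply: Mx1 => f fx //.
    by apply: contrapT => fy; apply: nf; exists f.
  by exists (zero_set f); split; [exact: measurable_zero_set|left].
Qed.
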